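(* Let $n\ge 4$ and $m=2n-2$, and let $\mathcal{G}_{n,m}$ be the set of all simple graphs (not necessarily connected) with $n$ vertices and $m$ edges. If $G'$ is any graph attaining the maximum $A_{1/2}$-spectral radius among all graphs in $\mathcal{G}_{n,m}$, then $G'\cong K_5\cup K_1$ when $n=6$, and $G'\cong S_{n,2n-2}$ when $n\neq 6$.
   Context: All graphs are finite, simple, undirected. For a graph $G$ with adjacency matrix $A(G)$ and diagonal degree matrix $D(G)$, and $\alpha\in[0,1)$, let $A_\alpha(G)=\alpha D(G)+(1-\alpha)A(G)$; its largest eigenvalue $\rho_\alpha(G)$ is the $A_\alpha$-spectral radius. (So $A_{1/2}(G)=\frac12(D(G)+A(G))$.) For $H_1,H_2$ disjoint graphs, $H_1\cup H_2$ is their disjoint union and $H_1\vee H_2$ is their join (disjoint union plus all edges between them). $K_t$ is the complete graph, $K_{1,a}$ the star with $a$ leaves ($K_{1,0}$ is a single vertex), and $tK_1$ is $t$ isolated vertices. Quasi-star graph: for $n$ and $m\ge n-1$, let $k$ be the largest integer with $m\ge\sum_{i=1}^k(n-i)$ and $a=m-\sum_{i=1}^k(n-i)$; then $S_{n,m}=K_k\vee\big(K_{1,a}\cup(n-a-k-1)K_1\big)$. *)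

(* Defs.v *)
From HB Require Import structures.
From mathcomp Require Import all_boot all_order all_algebra.
From mathcomp Require Import all_classical all_reals.

Set Implicit Arguments.
Unset Strict Implicit.
Unset Printing Implicit Defensive.

Import Order.TTheory GRing.Theory Num.Theory.

Record sgraph := SGraph {
  vertex :> finType;
  edge : rel vertex;
  edge_sym : symmetric edge;
  edge_irr : irreflexive edge }.

Definition edges (G : sgraph) : {set {set G}} :=
  [set e : {set G} | [exists x : G, exists y : G,
                        edge x y && (e == [set x; y])]].

Definition degree (G : sgraph) (x : G) : nat := #|[set y : G | edge x y]|.

Definition isomorphic (G H : sgraph) : Prop :=
  exists f : G -> H, bijective f /\ forall x y, edge (f x) (f y) = edge x y.

Section Constructions.

Variables G H : sgraph.

Definition union_rel (x y : (G + H)%type) : bool :=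
  match x, y with
  | inl u, inl v => edge u v
  | inr u, inr v => edge u v
  | _, _ => false
  end.

Lemma union_sym : symmetric union_rel.
Proof. by move=> [u|u] [v|v] //=; rewrite edge_sym. Qed.

Lemma union_irr : irreflexive union_rel.
Proof. by move=> [u|u] /=; rewrite edge_irr. Qed.

Definition gunion : sgraph := SGraph union_sym union_irr.

Definition join_rel (x y : (G + H)%type) : bool :=
  match x, y with
  | inl u, inl v => edge u v
  | inr u, inr v => edge u v
  | _, _ => true
  end.

Lemma join_sym : symmetric join_rel.
Proof. by move=> [u|u] [v|v] //=; rewrite edge_sym. Qed.

Lemma join_irr : irreflexive join_rel.
Proof. by move=> [u|u] /=; rewrite edge_irr. Qed.

Definition gjoin : sgraph := SGraph join_sym join_irr.

End Constructions.

Section BasicGraphs.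

Variable t : nat.

Definition complete_rel : rel 'I_t := fun i j => i != j.

Lemma complete_sym : symmetric complete_rel.
Proof. by move=> i j; rewrite /complete_rel eq_sym. Qed.

Lemma complete_irr : irreflexive complete_rel.
Proof. by move=> i; rewrite /complete_rel eqxx. Qed.

Definition complete : sgraph := SGraph complete_sym complete_irr.

Definition edgeless_rel : rel 'I_t := fun _ _ => false.

Lemma edgeless_sym : symmetric edgeless_rel.
Proof. by []. Qed.

Lemma edgeless_irr : irreflexive edgeless_rel.
Proof. by []. Qed.

Definition edgeless : sgraph := SGraph edgeless_sym edgeless_irr.

End BasicGraphs.

Definition star (a : nat) : sgraph := gjoin (edgeless 1) (edgeless a).

Definition qs_sum (n k : nat) : nat := \sum_(1 <= i < k.+1) (n - i).

(* The bound k < n is part of the definition: a graph on n vertices needs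
   k + 1 <= n in K_k v (K_{1,a} u (n-a-k-1)K_1), and the summand n - i is
   nonpositive for i >= n (e.g. k = n would tie with k = n - 1 for K_n). *)
Definition qs_k (n m : nat) : nat := \max_(k < n | qs_sum n k <= m) k.

Definition qs_a (n m : nat) : nat := m - qs_sum n (qs_k n m).

(* Meaningful for n - 1 <= m <= 'C(n, 2), where no subtraction truncates. *)
Definition quasi_star (n m : nat) : sgraph :=
  let k := qs_k n m in
  let a := qs_a n m in
  gjoin (complete k) (gunion (star a) (edgeless (n - a - k - 1))).

Local Open Scope ring_scope.

Section Spectrum.

Variable R : realType.

Definition adj_mx (G : sgraph) : 'M[R]_#|G| :=
  \matrix_(i, j) (edge (enum_val i) (enum_val j))%:R.

Definition deg_mx (G : sgraph) : 'M[R]_#|G| :=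
  diag_mx (\row_i (degree (enum_val i))%:R).

Definition A_alpha (alpha : R) (G : sgraph) : 'M[R]_#|G| :=
  alpha *: deg_mx G + (1 - alpha) *: adj_mx G.

(* The set of eigenvalues is finite, and nonempty when G has a vertex (the
   matrix is symmetric), so its supremum is the largest eigenvalue. *)
Definition rho_alpha (alpha : R) (G : sgraph) : R :=
  sup [set mu | eigenvalue (A_alpha alpha G) mu]%classic.

End Spectrum.

Definition graph_class (n m : nat) (G : sgraph) : Prop :=
  #|G| = n /\ #|edges G| = m.

Definition attains_max_rho (R : realType) (alpha : R) (n m : nat)
    (G : sgraph) : Prop :=
  graph_class n m G /\
  forall H : sgraph, graph_class n m H -> rho_alpha alpha H <= rho_alpha alpha G.

(* Main.v *)
(* Write Q = D + A = 2 A_{1/2}. A positive vector w with Q w <= c w bounds the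
   spectral radius of Q by c, and an eigenvector bounds it from below, so no
   spectral theorem is needed. Let S(v) be the sum of the degrees of the
   neighbours of v. With w = deg, the bound is c = max (d + S / d); counting
   edges bounds S in terms of d, and for n >= 8 the value d + S / d can exceed
   n + 2 - 4 / (n + 4) only at universal vertices. Two universal vertices leave exactly one other
   edge, which forces the quasi-star. For a single universal vertex, increasing
   its weight by a small factor brings every row below the largest eigenvalue of
   the quasi-star, a root of a cubic greater than n + 2 - 4 / (n + 4). The orders
   n = 5, 6, 7 need individual constants; for n = 6, K_5 u K_1 has eigenvalue 8,
   the value of d + S / d at a universal vertex, and reweighting the universal
   vertices pushes every other graph below 8. *)
Require Import Defs.
From HB Require Import structures.
From mathcomp Require Import all_boot all_order all_algebra.
From mathcomp Require Import all_classical all_reals.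
From mathcomp Require Import zify ring lra.

Set Implicit Arguments.
Unset Strict Implicit.
Unset Printing Implicit Defensive.

Import Order.TTheory GRing.Theory Num.Theory.

(** * Degree sums *)

Section Degrees.

Variable G : sgraph.
Implicit Types x y : G.

Definition nbr_sum x := \sum_(y | edge x y) degree y.

Lemma degreeE x : degree x = \sum_y edge x y.
Proof.
rewrite /degree cardsE -sum1_card big_mkcond /=.
by apply: eq_bigr => y _; rewrite unfold_in.
Qed.

Lemma handshake : \sum_(x : G) degree x = 2 * #|edges G|.
Proof.
have -> : \sum_(x : G) degree x = \sum_(p : G * G | edge p.1 p.2) 1.
  rewrite (eq_bigr _ (fun x _ => degreeE x)) pair_bigA /= [RHS]big_mkcond /=.
  by apply: eq_bigr => p _; case: edge.
(* Ordered adjacent pairs are grouped by their underlying edge; each fibre consists of [(x, y)] and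
   [(y, x)]. *)
rewrite (partition_big (fun p : G * G => [set p.1; p.2]) (mem (edges G))) /=; last first.
  move=> [x y] /= exy; rewrite inE; apply/existsP; exists x.
  by apply/existsP; exists y; rewrite exy eqxx.
rewrite -sum1_card big_distrr /=; apply: eq_bigr => e.
rewrite inE => /existsP[x /existsP[y /andP[exy /eqP ->]]].
have nxy : x != y by apply: contraTneq exy => ->; rewrite edge_irr.
have /card_uniqP /= <- : uniq [:: (x, y); (y, x)].
  by rewrite /= inE andbT xpair_eqE (negPf nxy).
rewrite sum1_card.
rewrite muln1; apply: eq_card => -[a b]; rewrite !inE !xpair_eqE unfold_in /=.
apply/idP/idP => [/andP[eab /eqP E]|].
  have nab : a != b by apply: contraTneq eab => ->; rewrite edge_irr.
  have := set21 a b; rewrite E !inE => ax; have := set22 a b; rewrite E !inE => bx.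
  by case/orP: ax bx nab => /eqP-> /orP[] /eqP->; rewrite !eqxx ?orbT.
case/orP=> /andP[/eqP-> /eqP->]; first by rewrite exy eqxx.
by rewrite edge_sym exy finset.setUC eqxx.
Qed.

Lemma degree_lt x : degree x < #|G|.
Proof.
rewrite /degree -cardsT; apply: proper_card; rewrite properE finset.subsetT /=.
by apply/subsetPn; exists x; rewrite !inE ?edge_irr.
Qed.

Lemma degree_gt0 x : (0 < degree x) = [exists y : G, edge x y].
Proof.
rewrite /degree card_gt0; apply/set0Pn/existsP => -[y];
  by rewrite ?inE => exy; exists y; rewrite ?inE.
Qed.

Lemma nonnbr_card x : #|[pred y | ~~ edge x y && (y != x)]| + degree x = #|G|.-1.
Proof.
rewrite /degree cardsE -!sum1_card [in RHS](bigID (edge x)) /=.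
by rewrite [X in (_ + X).-1](bigD1 x) ?edge_irr //= addnCA addnC.
Qed.

(** The vertices split into the neighbours of [x], [x] itself and the rest, so lower bounds on
    degrees in the rest become upper bounds on [nbr_sum x]. *)
Lemma nbr_sumE x :
  nbr_sum x + degree x + \sum_(y | ~~ edge x y && (y != x)) degree y
  = \sum_(y : G) degree y.
Proof.
rewrite [RHS](bigID (edge x)) /= -addnA; congr (_ + _).
by rewrite [RHS](bigD1 x) ?edge_irr.
Qed.

Lemma nbr_sum_le_total x : nbr_sum x + degree x <= \sum_(y : G) degree y.
Proof. by rewrite -(nbr_sumE x) leq_addr. Qed.

(** Each non-neighbour contributes at least 1, and their number plus [degree x] is [#|G|.-1]. *)
Lemma nbr_sum_le_no_isolated x :
  (forall y, 0 < degree y) -> nbr_sum x + #|G|.-1 <= \sum_(y : G) degree y.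
Proof.
move=> dgt0; rewrite -(nbr_sumE x) -(nonnbr_card x) addnCA addnC leq_add2l.
by rewrite -sum1_card; apply: leq_sum => y _.
Qed.

(* Each edge wz is counted [w ~ x] + [z ~ x] <= 1 + [w ~ x][z ~ x] times. *)
Lemma nbr_sum_le_half x :
  2 * nbr_sum x <= \sum_(y : G) degree y + degree x * (degree x).-1.
Proof.
pose a (y z : G) : nat := edge y z.
have E1 : nbr_sum x = \sum_y \sum_z a y z * a x y.
  rewrite /nbr_sum big_mkcond; apply: eq_bigr => y _.
  rewrite -big_distrl /= -degreeE /a; case: edge; rewrite ?muln1 ?muln0 //.
have E2 : nbr_sum x = \sum_y \sum_z a y z * a x z.
  rewrite E1 exchange_big /=; apply: eq_bigr => y _; apply: eq_bigr => z _.
  by rewrite /a [edge z y]edge_sym.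
have E3 : degree x * (degree x).-1 = \sum_y \sum_z (y != z) * (a x y * a x z).
  rewrite {1}degreeE big_distrl /=; apply: eq_bigr => y _.
  rewrite /a; case: (boolP (edge x y)) => exy; last first.
    by rewrite mul0n big1 // => z _; rewrite mul0n muln0.
  rewrite mul1n degreeE (bigD1 y) //= exy [RHS](bigD1 y) //= eqxx mul0n add0n /=.
  by apply: eq_bigr => z; rewrite eq_sym mul1n => ->; rewrite mul1n.
rewrite mul2n -addnn {1}E1 E2 E3.
rewrite (eq_bigr _ (fun y _ => degreeE y)) -!big_split /=; apply: leq_sum => y _.
rewrite -!big_split /=; apply: leq_sum => z _; rewrite /a.
case: (eqVneq y z) => [->|_]; first by rewrite edge_irr.
by case: (edge y z); case: (edge x y); case: (edge x z).
Qed.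

Lemma nbr_sum_le_max x B :
  (forall y, edge x y -> degree y <= B) -> nbr_sum x <= degree x * B.
Proof.
move=> dB; rewrite /nbr_sum /degree cardsE -sum_nat_const.
by apply: leq_sum => y; exact: dB.
Qed.

Lemma degree_full x : degree x = #|G|.-1 -> forall y, edge x y = (x != y).
Proof.
move=> dx y; have := nonnbr_card x; rewrite dx -[RHS]add0n => /addIn /eqP /pred0P /(_ y) /=; rewrite eq_sym.
by case: eqP => [->|]; rewrite ?edge_irr //= andbT => _ /negbFE.
Qed.

Lemma universal_no_isolated (u : G) : 1 < #|G| -> degree u = #|G|.-1 ->
  forall y : G, 0 < degree y.
Proof.
move=> n1 du y; have eu := degree_full du.
have [->|yu] := eqVneq y u; first by rewrite du -ltnS prednK // ltnW.
by rewrite degree_gt0; apply/existsP; exists u; rewrite edge_sym eu eq_sym.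
Qed.

Lemma isolated_edge w y : degree w = 0 -> edge w y = false.
Proof.
by move=> dw; apply: contra_eqF dw => ewy; rewrite -lt0n degree_gt0; apply/existsP; exists y.
Qed.

(** Degree [#|G| - 2] leaves room for a single non-neighbour, and [w] takes it. *)
Lemma edge_of_codegree1 w x : degree x = #|G| - 2 -> x != w -> ~~ edge x w ->
  forall y, edge x y = (x != y) && (y != w).
Proof.
move=> dx xw exw y; case: (eqVneq x y) => [<-|xy]; first by rewrite edge_irr.
case: (eqVneq y w) => [->|yw]; first exact: negbTE.
have /eqP := nonnbr_card x; rewrite dx (_ : #|G|.-1 = 1 + (#|G| - 2)); last first.
  by have : 1 < #|G|; [rewrite (cardD1 x) (cardD1 w) !inE eq_sym xw | lia].
rewrite eqn_add2r (cardD1 w) inE /= exw [w == x]eq_sym xw eqSS => /eqP/card0_eq /(_ y).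
by rewrite !inE yw [y == x]eq_sym xy andbT /= => /negbFE.
Qed.

End Degrees.

(** * Eigenvectors and test vectors *)

Section Spectral.

Local Open Scope ring_scope.
Variables (R : realType) (G : sgraph).
Implicit Types (f w : G -> R) (c l : R).

(** The signless Laplacian, twice the matrix for alpha = 1/2, acting on functions on vertices
    instead of row vectors indexed by ordinals. *)
Definition signless f (v : G) : R :=
  (degree v)%:R * f v + \sum_(u | edge v u) f u.

Lemma mulmx_A_half (v : 'rV[R]_#|G|) (x : G) :
  (v *m A_alpha 2^-1 G) 0 (enum_rank x) = 2^-1 * signless (fun y => v 0 (enum_rank y)) x.
Proof.
rewrite mxE (reindex (@enum_rank G)) /=; last exact: onW_bij (enum_rank_bij _).
rewrite /signless mulrDr mulr_sumr [in RHS]big_mkcond /=.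
have -> : 2^-1 * ((degree x)%:R * v 0 (enum_rank x))
  = \sum_y (if y == x then 2^-1 * ((degree x)%:R * v 0 (enum_rank x)) else 0).
  by rewrite -big_mkcond big_pred1_eq.
rewrite -big_split /=; apply: eq_bigr => y _.
rewrite !mxE !enum_rankK (inj_eq enum_rank_inj) [edge y x]edge_sym.
have -> : 1 - 2^-1 = 2^-1 :> R by lra.
by case: (eqVneq y x) => [->|_]; case: edge; rewrite ?mulr1n ?mulr0n /=; ring.
Qed.

(** Let [f] be an eigenvector and [y] a vertex where [|f| / w] attains its maximum [t]. The triangle
    inequality gives [2 * l * |f y| <= t * signless w y <= c * t * w y = c * |f y|]. *)
Lemma eigenvalue_le w c l : (forall v, 0 < w v) ->
  (forall v, signless w v <= c * w v) ->
  eigenvalue (A_alpha 2^-1 G) l -> l <= c / 2.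
Proof.
move=> w_gt0 Hw /eigenvalueP[v Hv v0].
pose f (x : G) := v 0 (enum_rank x).
have Hf x : signless f x = 2 * l * f x.
  have := mulmx_A_half v x; rewrite Hv mxE => E.
  rewrite /f -mulrA E; lra.
have [x0 fx0] : exists x0, f x0 != 0.
  have /rV0Pn[i vi] := v0.
  by exists (enum_val i); rewrite /f enum_valK.
have [y _ ymax] := Order.TotalTheory.arg_maxP (fun x : G => `|f x| / w x) (isT : xpredT x0).
pose t := `|f y| / w y.
have t_gt0 : 0 < t.
  apply: lt_le_trans (ymax x0 isT); by rewrite divr_gt0 ?normr_gt0.
have fle x : `|f x| <= t * w x by rewrite -ler_pdivrMr //; exact: ymax.
have fy : `|f y| = t * w y by rewrite /t divfK // gt_eqF.
suff : 2 * l * `|f y| <= c * `|f y|.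
  rewrite ler_pM2r; first by move=> ?; rewrite ler_pdivlMr // mulrC.
  by rewrite fy mulr_gt0.
have : `|signless f y| <= t * signless w y.
  apply: (le_trans (ler_normD _ _)); rewrite /signless mulrDr lerD //.
    by rewrite normrM fy normr_nat mulrCA.
  rewrite mulr_sumr; apply: (le_trans (ler_norm_sum _ _ _)).
  by apply: ler_sum => u _; exact: fle.
rewrite Hf normrM => H1.
apply: (le_trans (ler_wpM2r (normr_ge0 _) (ler_norm _))).
apply: (le_trans H1); rewrite fy mulrCA ler_pM2l //; exact: Hw.
Qed.

Lemma rho_le w c : 0 <= c -> (forall v, 0 < w v) ->
  (forall v, signless w v <= c * w v) -> rho_alpha (2^-1 : R) G <= c / 2.
Proof.
move=> c0 w_gt0 Hw; rewrite /rho_alpha.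
set E := (X in sup X).
(* No eigenvalue is known to exist here; on the empty set [sup] is 0, and [0 <= c] settles that
   case. *)
have [E0|/set0P E0] := eqVneq E set0; first by rewrite E0 sup0 divr_ge0.
by apply: ge_sup => // l /=; exact: eigenvalue_le.
Qed.

Lemma rho_ge f l x : f x != 0 -> (forall v, signless f v = l * f v) ->
  l / 2 <= rho_alpha (2^-1 : R) G.
Proof.
move=> fx0 Hf; have eigen_l : eigenvalue (A_alpha 2^-1 G) (l / 2).
  apply/eigenvalueP; exists (\row_i f (enum_val i)).
    apply/rowP => i; rewrite -[i]enum_valK mulmx_A_half !mxE enum_rankK.
    rewrite (_ : signless _ _ = l * f (enum_val i)); first by ring.
    rewrite -Hf /signless !mxE enum_rankK; congr (_ + _).
    by apply: eq_bigr => u _; rewrite mxE enum_rankK.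
  by apply/rV0Pn; exists (enum_rank x); rewrite mxE enum_rankK.
apply: sup_upper_bound => //; split; first by exists (l / 2).
(* The supremum is an upper bound only if the set is bounded; the constant test vector, with row
   sums [2 * degree v], shows this. *)
exists ((2 * #|G|%:R) / 2) => m /=; apply: (@eigenvalue_le (fun=> 1)) => // v.
rewrite /signless !mulr1 sumr_const.
rewrite (_ : #|[pred u | edge v u]| = degree v); last by rewrite /degree cardsE.
have : ((degree v)%:R <= #|G|%:R :> R) by rewrite ler_nat max_card.
set d : R := _%:R; set N : R := _%:R; lra.
Qed.

End Spectral.

Section Weights.

Local Open Scope ring_scope.
Variables (R : realType) (G : sgraph).

(* Test vector: the degrees, multiplied by [1 + t] on P (and 1 on isolated
   vertices, to keep it positive). *)
Lemma rho_le_weighted (P : pred G) (D : nat) (t c : R) :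
  0 <= t -> 0 <= c -> (0 < D)%N -> (forall v, P v -> degree v = D) ->
  (forall v, ~~ P v -> (0 < degree v)%N ->
     (degree v)%:R ^+ 2 + (nbr_sum v)%:R + t * D%:R * #|[pred u | edge v u & P u]|%:R
       <= c * (degree v)%:R) ->
  (forall v, P v ->
     D%:R ^+ 2 * (1 + t) + (nbr_sum v)%:R + t * D%:R * #|[pred u | edge v u & P u]|%:R
       <= c * (D%:R * (1 + t))) ->
  rho_alpha (2^-1 : R) G <= c / 2.
Proof.
move=> t0 c0 D0 PD HN HP.
pose w v : R := if degree v == 0%N then 1
                else (degree v)%:R * (1 + t * (P v)%:R).
have w_gt0 v : 0 < w v.
  rewrite /w; case: posnP => // d0; rewrite mulr_gt0 ?ltr0n // ltr_wpDr //.
  by rewrite mulr_ge0 ?ler0n.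
apply: (@rho_le _ _ w) => // v.
(* A neighbour of [v] is not isolated, so the default weight 1 enters no other row. *)
have wN u : edge v u -> w u = (degree u)%:R + t * D%:R * (P u)%:R.
  move=> evu; rewrite /w; case: posnP => [d0|_].
    by have := degree_gt0 u; rewrite d0 => /esym/existsP[]; exists v; rewrite edge_sym.
  case: (boolP (P u)) => Pu; last by rewrite !mulr0 addr0 mulr1 addr0.
  by rewrite PD //; ring.
have -> : signless w v = (degree v)%:R * w v + (nbr_sum v)%:R
     + t * D%:R * #|[pred u | edge v u & P u]|%:R.
  rewrite /signless -addrA; congr (_ + _); rewrite (eq_bigr _ wN) big_split /=.
  rewrite -mulr_sumr -natr_sum; congr (_ + _ * _).
  rewrite -sum1_card big_mkcondr /= natr_sum; apply: eq_bigr => u _.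
  by case: (P u).
case: (posnP (degree v)) => [d0|d0].
  have nov u : edge v u = false by exact: isolated_edge.
  rewrite /nbr_sum big_pred0 // d0 mul0r !add0r eq_card0 ?mulr0; last first.
    by move=> u; rewrite !inE nov.
  by rewrite /w d0 mulr1.
have := HN v; have := HP v; rewrite /w eqn0Ngt d0 /=.
case: (boolP (P v)) => Pv HPv HNv; last first.
  by have := HNv isT isT; rewrite !mulr0 addr0 !mulr1 expr2.
by have := HPv isT; rewrite (PD _ Pv) !mulr1 expr2 -!mulrA.
Qed.

End Weights.

(** Vertices outside the list all have index [size s], so adjacency cannot tell them apart.
    Completing both lists arbitrarily and matching positions gives the isomorphism. *)
Lemma isomorphic_of_prefix (G H : sgraph) (s : seq G) (s' : seq H) (E : rel nat) :
  (0 < #|G|)%N -> #|G| = #|H| -> uniq s -> uniq s' -> size s = size s' ->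
  (forall x y, edge x y = (x != y) && E (index x s) (index y s)) ->
  (forall x y, edge x y = (x != y) && E (index x s') (index y s')) ->
  isomorphic G H.
Proof.
pose full (K : sgraph) (r : seq K) := r ++ [seq x <- enum K | x \notin r].
have full_uniq (K : sgraph) (r : seq K) : uniq r -> uniq (full K r).
  move=> ur; rewrite cat_uniq ur filter_uniq ?enum_uniq // andbT.
  by apply/hasPn => x; rewrite mem_filter => /andP[].
have full_mem (K : sgraph) (r : seq K) x : x \in full K r.
  by rewrite mem_cat mem_filter mem_enum andbT orbN.
have full_size (K : sgraph) (r : seq K) : uniq r -> size (full K r) = #|K|.
  move=> ur; rewrite cardE; apply/perm_size/uniq_perm; rewrite ?enum_uniq ?full_uniq //.
  by move=> x; rewrite full_mem mem_enum.
have full_index (K : sgraph) (r : seq K) x : index x r = minn (index x (full K r)) (size r).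
  rewrite index_cat; case: ifPn => [xr|/memNindex ->].
    by apply/esym/minn_idPl; rewrite index_size.
  by apply/esym/minn_idPr; rewrite leq_addr.
move=> G0 GH us us' ss' EG EH.
have /card_gt0P[x0 _] := G0; have /card_gt0P[y0 _] : (0 < #|H|)%N by rewrite -GH.
pose f x := nth y0 (full H s') (index x (full G s)).
pose g y := nth x0 (full G s) (index y (full H s')).
have fi x : index (f x) (full H s') = index x (full G s).
  by rewrite index_uniq ?full_uniq // full_size // -GH -(full_size _ s) // index_mem.
have gi y : index (g y) (full G s) = index y (full H s').
  by rewrite index_uniq ?full_uniq // full_size // GH -(full_size _ s') // index_mem.
have fK : cancel f g by move=> x; rewrite /g fi nth_index.
have gK : cancel g f by move=> y; rewrite /f gi nth_index.
exists f; split; first by exists g.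
move=> x y; rewrite EG EH (inj_eq (can_inj fK)).
by rewrite !(full_index H s') !fi !(full_index G s) ss'.
Qed.

(** Positions 0 and 1 are the universal vertices, 2 and 3 the ends of the one further edge, and 4
    stands for every other vertex. *)
Definition quasi_star_rel : rel nat :=
  fun i j => [|| i < 2, j < 2 | (i < 4) && (j < 4)].

(** * The extremal graphs *)

Section QuasiStar.

(** The first two summands leave a remainder of 1, less than the third summand [n - 3] because
    [n > 4]. *)
Lemma qs_k_2n2 n : 4 < n -> qs_k n (2 * n - 2) = 2.
Proof.
move=> n4; apply/eqP; rewrite eqn_leq; apply/andP; split.
  apply/bigmax_leqP => k; rewrite /qs_sum; apply: contraTT; rewrite -!ltnNge => k2.
  rewrite (@big_cat_nat _ _ _ 4) //=.
  rewrite big_ltn // big_ltn // big_ltn // big_geq //; lia.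
have n2 : 2 < n by lia.
apply: (@leq_bigmax_cond _ (fun k : 'I_n => qs_sum n k <= 2 * n - 2)
  (fun k => nat_of_ord k) (Ordinal n2)).
rewrite /qs_sum /= big_ltn // big_ltn // big_geq //; lia.
Qed.

Lemma qs_a_2n2 n : 4 < n -> qs_a n (2 * n - 2) = 1.
Proof.
move=> n4; rewrite /qs_a qs_k_2n2 // /qs_sum big_ltn // big_ltn // big_geq //; lia.
Qed.

Lemma quasi_star_2n2 n : 4 < n ->
  quasi_star n (2 * n - 2) =
  gjoin (complete 2) (gunion (star 1) (edgeless (n - 4))).
Proof.
move=> n4; rewrite /quasi_star qs_k_2n2 // qs_a_2n2 // -!subnDA; do 3 f_equal; lia.
Qed.

(** At order 4 the third summand is 1 and still fits, so the quasi-star is [K_4] and needs separate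
    treatment. *)
Lemma quasi_star_4 : quasi_star 4 6 = gjoin (complete 3) (gunion (star 0) (edgeless 0)).
Proof.
have k3 : qs_k 4 6 = 3.
  apply/eqP; rewrite eqn_leq; apply/andP; split.
    by apply/bigmax_leqP => k _; rewrite -ltnS.
  apply: (@leq_bigmax_cond _ (fun k : 'I_4 => qs_sum 4 k <= 6)
    (fun k => nat_of_ord k) (Ordinal (isT : 3 < 4))).
  by rewrite /qs_sum /= 3?big_ltn // big_geq.
have a0 : qs_a 4 6 = 0 by rewrite /qs_a k3 /qs_sum 3?big_ltn // big_geq.
by rewrite /quasi_star k3 a0.
Qed.

Variable p : nat.
Let T := gjoin (complete 2) (gunion (star 1) (edgeless p)).

Lemma card_qs : #|T| = p + 4.
Proof. by rewrite /T !card_sum !card_ord; lia. Qed.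

Lemma qs_degree (x : T) :
  degree x = match x with inl _ => p + 3 | inr (inl _) => 3 | inr (inr _) => 2 end.
Proof.
case: x => [i|[[i|i]|i]]; rewrite degreeE !big_sumType /=.
all: rewrite ?big_ord_recl ?big_ord0 /= ?sum_nat_const ?card_ord ?muln1 ?muln0 //.
by case: i => [[|[|//]] ?] /=; rewrite /complete_rel /=; lia.
Qed.

Lemma qs_edges : #|edges T| = 2 * p + 6.
Proof.
have := handshake T; rewrite (eq_bigr _ (fun x _ => qs_degree x)) !big_sumType /=.
by rewrite !sum_nat_const !card_ord; lia.
Qed.

Lemma qs_shape : exists s : seq T, [/\ uniq s, size s = 4 &
  forall x y, edge x y = (x != y) && quasi_star_rel (index x s) (index y s)].
Proof.
pose s : seq T := [:: inl ord0; inl ord_max; inr (inl (inl ord0)); inr (inl (inr ord0))].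
have idx (x : T) : index x s =
    match x with inl i => i | inr (inl (inl _)) => 2 | inr (inl (inr _)) => 3
               | inr (inr _) => 4 end.
  case: x => [i|[[i|i]|i]] //; last by rewrite (ord1 i).
    by case: i => [[|[|//]] ?].
  by rewrite (ord1 i).
have inl_adj (i : 'I_2) j : quasi_star_rel i j by rewrite /quasi_star_rel ltn_ord.
have inr_adj i (j : 'I_2) : quasi_star_rel i j by rewrite /quasi_star_rel ltn_ord orbT.
exists s; split=> [||x y] //; rewrite -/(quasi_star_rel _ _) !idx.
case: x y => [i|x] [j|y]; rewrite ?inl_adj ?inr_adj ?andbT //.
by case: x y => [[i|i]|i] [[j|j]|j]; rewrite ?(ord1 i) ?(ord1 j) ?eqxx ?andbF.
Qed.

Section Eigen.
Local Open Scope ring_scope.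
Variable R : realType.

(** With value 1 on the universal vertices, the rows of the extra edge and of the remaining vertices
    force [2 / (l - 4)] and [2 / (l - 2)]; the cubic is the universal row with denominators
    cleared. *)
Lemma qs_rho_ge (l : R) : 4 < l ->
  (l - (p + 4)%:R) * (l - 4) * (l - 2) = 4 * (l - 2) + 2 * p%:R * (l - 4) ->
  l / 2 <= rho_alpha (2^-1 : R) T.
Proof.
move=> l4 Hl.
pose f (x : T) : R := match x with
  | inl _ => 1 | inr (inl _) => 2 / (l - 4) | inr (inr _) => 2 / (l - 2) end.
apply: (@rho_ge R T f l (inl ord0)); first by rewrite oner_eq0.
have l40 : l - 4 != 0 by rewrite gt_eqF // subr_gt0.
have l20 : l - 2 != 0 by rewrite gt_eqF //; lra.
move=> x; rewrite /signless qs_degree big_mkcond /= !big_sumType /=.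
case: x => [i|[[i|i]|i]] /=; rewrite !big_ord_recl !big_ord0 /= sumr_const card_ord ?mul0rn.
- have -> : (if complete_rel i ord0 then 1 else 0)
    + ((if complete_rel i (lift ord0 ord0) then 1 else 0) + 0) = 1 :> R.
    by case: i => [[|[|//]] ?]; rewrite /complete_rel /= ?addr0 ?add0r.
  have E : l - (p + 4)%:R = (4 * (l - 2) + 2 * p%:R * (l - 4)) / ((l - 4) * (l - 2)).
    by rewrite -Hl; field; rewrite l40 l20.
  rewrite !mulr1 -[RHS](subrK (p + 4)%:R) E -[_ *+ p]mulr_natr (natrD _ p 3) (natrD _ p 4).
  by field; rewrite l40 l20.
- by field.
- by field.
- by field.
Qed.

Lemma qs_rho_gt (c : R) : 4 < c -> c <= (p + 6)%:R ->
  (c - (p + 4)%:R) * (c - 4) * (c - 2) < 4 * (c - 2) + 2 * p%:R * (c - 4) ->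
  c / 2 < rho_alpha (2^-1 : R) T.
Proof.
move=> c4 cp Hc; set N : R := p%:R in Hc.
have N0 : 0 <= N by rewrite ler0n.
have E4 : (p + 4)%:R = N + 4 :> R by rewrite natrD.
have E6 : (p + 6)%:R = N + 6 :> R by rewrite natrD.
pose q : {poly R} := ('X - (N + 4)%:P) * ('X - 4%:P) * ('X - 2%:P)
  - (4%:P * ('X - 2%:P) + (2 * N)%:P * ('X - 4%:P)).
have qE z : q.[z] = (z - (N + 4)) * (z - 4) * (z - 2)
    - (4 * (z - 2) + 2 * N * (z - 4)) by rewrite /q !hornerE.
(* The cubic is negative at [c] and equals [4 * N] at [N + 6], so it has a root in between; the
   strict inequality at [c] excludes [c] itself. *)
have [|l /andP[cl _] /rootP] := @poly_ivt R q c (p + 6)%:R cp.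
  rewrite !qE E6 subr_le0 -E4 (ltW Hc) /= E4.
  by rewrite (_ : _ - _ = 4 * N); [rewrite mulr_ge0 | ring].
rewrite qE => /eqP; rewrite subr_eq0 -E4 => /eqP Hl.
have ltcl : c < l.
  rewrite lt_neqAle cl andbT; apply/eqP => E; move: Hl Hc; rewrite -E => ->.
  by rewrite ltxx.
apply: lt_le_trans (qs_rho_ge (lt_trans c4 ltcl) Hl).
by rewrite ltr_pM2r ?invr_gt0.
Qed.

End Eigen.
End QuasiStar.

(** * Recognizing the extremal graphs from their degrees *)

Section Shapes.

Variable G : sgraph.

Lemma two_universal_shape (u1 u2 : G) : u1 != u2 ->
  degree u1 = #|G|.-1 -> degree u2 = #|G|.-1 ->
  \sum_(x : G) degree x = 4 * #|G|.-1 ->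
  exists s : seq G, [/\ uniq s, size s = 4 &
  forall x y, edge x y = (x != y) && quasi_star_rel (index x s) (index y s)].
Proof.
move=> u12 d1 d2 tot.
pose out (x : G) := (x != u1) && (x != u2).
have e1 := degree_full d1; have e2 := degree_full d2.
have split_sum (F : G -> nat) : \sum_x F x = F u1 + F u2 + \sum_(x | out x) F x.
  by rewrite (bigD1 u1) // (bigD1 u2) 1?eq_sym //= addnA.
have dout x : out x -> degree x = 2 + \sum_(y | out y) edge x y.
  case/andP=> x1 x2; rewrite degreeE split_sum.
  by rewrite ![edge x u1]edge_sym ![edge x u2]edge_sym e1 e2 ![_ == x]eq_sym x1 x2.
have cout : \sum_(x | out x) 1 = #|G| - 2.
  by have := split_sum (fun=> 1); rewrite sum1_card => ->; lia.
have G1 : 1 < #|G| by have := split_sum (fun=> 1); rewrite sum1_card => ->; lia.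
(* The other vertices have degree sum [2 * (n - 1)] for [n = #|G|]; the edges to [u1] and [u2] use
   [2 * (n - 2)] of it, leaving one edge counted twice. *)
have tot2 : \sum_(x | out x) \sum_(y | out y) edge x y = 2.
  move: tot; rewrite split_sum d1 d2 (eq_bigr _ dout) big_split /=.
  have -> : \sum_(x | out x) 2 = 2 * \sum_(x | out x) 1 by rewrite big_distrr.
  rewrite cout; set X := (X in _ + (_ + X)) => E; suff: X = 2 by [].
  by move: G1 E; clearbody X; move: #|G| => n; clear; lia.
pose B := [set p : G * G | [&& out p.1, out p.2 & edge p.1 p.2]].
have cB : #|B| = 2.
  rewrite -tot2 pair_big /= -sum1_card [RHS]big_mkcond [LHS]big_mkcond /=.
  by apply: eq_bigr => p _; rewrite inE andbA; case: (out p.1 && out p.2).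
have [p] : exists p, p \in B by apply/card_gt0P; rewrite cB.
case: p => z1 z2; rewrite inE /= => /and3P[o1 o2 e12].
have z12 : z1 != z2 by apply: contraTneq e12 => ->; rewrite edge_irr.
have BE : [set (z1, z2); (z2, z1)] = B.
  apply/eqP; rewrite eqEcard cB cards2 xpair_eqE (negPf z12) /= andbT.
  by apply/fintype.subsetP => p; rewrite !inE => /orP[] /eqP-> /=; rewrite o1 o2 //= edge_sym.
case/andP: o1 o2 => z11 z12' /andP[z21 z22].
pose s := [:: u1; u2; z1; z2].
have us : uniq s.
  by rewrite /= !inE !negb_or u12 ![u1 == _]eq_sym ![u2 == _]eq_sym z11 z12' z21 z22 z12.
have idx x : index x s = if x == u1 then 0 else if x == u2 then 1 else
                         if x == z1 then 2 else if x == z2 then 3 else 4.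
  by rewrite /= ![_ == x]eq_sym; do !case: ifP.
have sym : symmetric quasi_star_rel.
  by move=> i j; rewrite /quasi_star_rel orbCA [(i < 4) && _]andbC.
have key : forall x y, out x -> out y ->
    edge x y = (x != y) && quasi_star_rel (index x s) (index y s).
  move=> x y ox oy; have -> : edge x y = ((x, y) \in B) by rewrite inE /= ox oy.
  rewrite -BE !inE !xpair_eqE !idx.
  case/andP: ox oy => /negPf-> /negPf-> /andP[/negPf-> /negPf->].
  have [?|?] := eqVneq x z1; have [?|?] := eqVneq x z2;
  have [?|?] := eqVneq y z1; have [?|?] := eqVneq y z2.
  all: subst; rewrite /quasi_star_rel /= ?eqxx ?andbF ?andbT //.
  all: try by rewrite eqxx in z12.
have key1 y : edge u1 y = (u1 != y) && quasi_star_rel (index u1 s) (index y s).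
  by rewrite e1 idx eqxx andbT.
have key2 y : edge u2 y = (u2 != y) && quasi_star_rel (index u2 s) (index y s).
  by rewrite e2 idx eqxx [u2 == u1]eq_sym (negPf u12) andbT.
exists s; split=> [||x y] //; rewrite -/(quasi_star_rel _ _).
have [/eqP->|x1] := boolP (x == u1); first exact: key1.
have [/eqP->|x2] := boolP (x == u2); first exact: key2.
have [/eqP->|y1] := boolP (y == u1); first by rewrite edge_sym eq_sym sym; exact: key1.
have [/eqP->|y2] := boolP (y == u2); first by rewrite edge_sym eq_sym sym; exact: key2.
by apply: key; rewrite /out ?x1 ?y1.
Qed.

Lemma K5_K1_shape (w : G) : #|G| = 6 -> degree w = 0 ->
  (forall x, x != w -> degree x = 4) ->
  forall x y, edge x y = (x != y) && ((x != w) && (y != w)).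
Proof.
move=> G6 dw d4.
have ew y : edge w y = false by exact: isolated_edge.
move=> x y; case: (eqVneq x w) => [->|xw]; first by rewrite ew andbF.
by apply: edge_of_codegree1; rewrite ?G6 ?d4 // edge_sym ew.
Qed.

End Shapes.

Section Targets.

Lemma K5_K1_sum : \sum_(x : gunion (complete 5) (complete 1)) degree x = 20.
Proof.
rewrite big_sumType /= [X in X + _](eq_bigr (fun=> 4)); last first.
  by case=> [[|[|[|[|[|//]]]]] ?] _; rewrite degreeE big_sumType /= !big_ord_recl !big_ord0.
by rewrite !big_ord_recl !big_ord0 /= degreeE big_sumType /= !big_ord_recl !big_ord0.
Qed.

Lemma K5_K1_class : graph_class 6 10 (gunion (complete 5) (complete 1)).
Proof.
split; first by rewrite card_sum !card_ord.
by apply/eqP; rewrite -(eqn_pmul2l (isT : 0 < 2)) -handshake K5_K1_sum.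
Qed.

Lemma K5_K1_rho (R : realType) :
  (8 / 2 <= rho_alpha (2^-1 : R) (gunion (complete 5) (complete 1)))%R.
Proof.
(* The indicator of [K_5] is an eigenvector with eigenvalue 4 + 4 = 8. *)
pose f (x : gunion (complete 5) (complete 1)) : R := if x is inl _ then 1%R else 0%R.
apply: (@rho_ge R _ f _ (inl ord0)); first by rewrite oner_eq0.
case=> [i|i]; rewrite /signless degreeE [in X in (_ + X)%R]big_mkcond !big_sumType /=.
  rewrite !big_ord_recl !big_ord0 /=.
  by case: i => [[|[|[|[|[|//]]]]] ?]; rewrite /complete_rel /=; lra.
by rewrite !mulr0 !big1 ?addr0 //= => j _; case: ifP.
Qed.

End Targets.

(** * Upper bounds *)

Section Bounds.

Variables (R : realType) (G : sgraph).
Let n := #|G|.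

(** The weighted bound with [c = a / b] and [t = s / r], each row multiplied by [b * r], so that
    only natural-number inequalities remain to be checked. *)
Lemma rho_le_weighted_nat (P : pred G) (D a b r s : nat) :
  0 < b -> 0 < r -> 0 < D -> (forall v, P v -> degree v = D) ->
  (forall v, ~~ P v -> 0 < degree v ->
     b * (r * (degree v ^ 2 + nbr_sum v) + s * D * #|[pred u | edge v u & P u]|)
       <= a * r * degree v) ->
  (forall v, P v ->
     b * (D ^ 2 * (r + s) + r * nbr_sum v + s * D * #|[pred u | edge v u & P u]|)
       <= a * D * (r + s)) ->
  (rho_alpha (2^-1 : R) G <= a%:R / b%:R / 2)%R.
Proof.
move=> b0 r0 D0 PD HN HP.
have b0' : (0 < b%:R :> R)%R by rewrite ltr0n.
have r0' : (0 < r%:R :> R)%R by rewrite ltr0n.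
have b1 : (b%:R != 0 :> R)%R by rewrite gt_eqF.
have r1 : (r%:R != 0 :> R)%R by rewrite gt_eqF.
apply: (@rho_le_weighted R G P D (s%:R / r%:R)) => //; rewrite ?divr_ge0 //.
- move=> v Pv dv; have := HN v Pv dv; rewrite -(ler_nat R).
  rewrite !natrM !natrD !natrM !natrD ?natrX => H.
  rewrite -(ler_pM2l (mulr_gt0 b0' r0')).
  have -> : (b%:R * r%:R * (a%:R / b%:R * (degree v)%:R)
            = a%:R * r%:R * (degree v)%:R :> R)%R by field; rewrite b1.
  by apply: le_trans H; rewrite le_eqVlt; apply/orP; left; apply/eqP; field; rewrite r1.
- move=> v Pv; have := HP v Pv; rewrite -(ler_nat R).
  rewrite !natrM !natrD !natrM !natrD ?natrX => H.
  rewrite -(ler_pM2l (mulr_gt0 b0' r0')).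
  have -> : (b%:R * r%:R * (a%:R / b%:R * (D%:R * (1 + s%:R / r%:R)))
            = a%:R * D%:R * (r%:R + s%:R) :> R)%R by field; rewrite b1 r1.
  by apply: le_trans H; rewrite le_eqVlt; apply/orP; left; apply/eqP; field; rewrite r1.
Qed.

Lemma rho_le_degree_nat (a b : nat) : 0 < b ->
  (forall v : G, 0 < degree v -> b * (degree v ^ 2 + nbr_sum v) <= a * degree v) ->
  (rho_alpha (2^-1 : R) G <= a%:R / b%:R / 2)%R.
Proof.
move=> b0 H; apply: (@rho_le_weighted_nat pred0 1 a b 1 0) => // v _ dv.
by rewrite !mul0n addn0 mul1n muln1; exact: H.
Qed.

Hypothesis total : \sum_(x : G) degree x = 4 * n.-1.

(** Only [u] is reweighted, so a row depends just on a degree [d] and a neighbour sum [S]. The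
    bounds on [S] come from the absence of isolated vertices, from edge counting, and from [u] being
    the only neighbour of degree above [n - 2]. *)
Lemma rho_le_unique_universal (u : G) (a b r s : nat) :
  1 < n -> 0 < b -> 0 < r -> degree u = n.-1 ->
  (forall v : G, v != u -> degree v <= n - 2) ->
  b * (n.-1 * (r + s) + 3 * r) <= a * (r + s) ->
  (forall d S, 0 < d <= n - 2 -> S <= 3 * n.-1 -> 2 * S <= 4 * n.-1 + d * d.-1 ->
     S <= n.-1 + d.-1 * (n - 2) -> b * (r * (d ^ 2 + S) + s * n.-1) <= a * r * d) ->
  (rho_alpha (2^-1 : R) G <= a%:R / b%:R / 2)%R.
Proof.
move=> n1 b0 r0 du dv Hu Hv.
have eu := degree_full du.
have pos := universal_no_isolated n1 du.
apply: (@rho_le_weighted_nat (pred1 u) n.-1 a b r s) => //.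
- by lia.
- by move=> v /eqP->.
- move=> v /= vu dv0.
  have -> : #|[pred w | edge v w & w == u]| = 1.
    rewrite -(card1 u); apply: eq_card => w; rewrite !inE andbC.
    by case: eqP => // ->; rewrite edge_sym eu eq_sym.
  rewrite muln1; apply: Hv.
  + by rewrite dv0 dv.
  + by have := nbr_sum_le_no_isolated v pos; rewrite total -/n; lia.
  + by have := nbr_sum_le_half v; rewrite total.
  + have euv : edge v u by rewrite edge_sym eu eq_sym.
    rewrite /nbr_sum (bigD1 u) //= du leq_add2l.
    have -> : (degree v).-1 = #|[pred w | edge v w & w != u]|.
      by rewrite /degree cardsE -!sum1_card (bigD1 u).
    by rewrite -sum_nat_const; apply: leq_sum => w /andP[_]; exact: dv.
- move=> v /eqP ->.
  have -> : #|[pred w | edge u w & w == u]| = 0.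
    by apply: eq_card0 => w; rewrite !inE; case: eqP => [->|]; rewrite ?edge_irr ?andbF.
  (* All other vertices are neighbours of [u]; the factor [n.-1] then cancels from its row, leaving
     [Hu]. *)
  have Su : nbr_sum u = 3 * n.-1.
    have := nbr_sumE u; rewrite total du big_pred0 ?addn0; first by lia.
    by move=> w; rewrite eu negbK eq_sym andbN.
  rewrite Su muln0 addn0.
  rewrite (_ : b * _ = n.-1 * (b * (n.-1 * (r + s) + 3 * r))); last by ring.
  by rewrite (_ : a * _ * _ = n.-1 * (a * (r + s))) ?leq_mul2l ?Hu ?orbT //; ring.
Qed.

(** Isolated vertices may occur here, so the degree total yields only [S + d <= 4 * n.-1]. *)
Lemma rho_le_no_universal (a b : nat) : 0 < b ->
  (forall v : G, degree v <= n - 2) ->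
  (forall d S, 0 < d <= n - 2 -> S + d <= 4 * n.-1 -> 2 * S <= 4 * n.-1 + d * d.-1 ->
     S <= d * (n - 2) -> b * (d ^ 2 + S) <= a * d) ->
  (rho_alpha (2^-1 : R) G <= a%:R / b%:R / 2)%R.
Proof.
move=> b0 dv H; apply: rho_le_degree_nat => // v dv0; apply: H.
- by rewrite dv0 dv.
- by rewrite -total nbr_sum_le_total.
- by rewrite -total nbr_sum_le_half.
- by apply: nbr_sum_le_max => y _.
Qed.

End Bounds.

(** * Polynomial inequalities for orders at least 8 *)

Section RowInequalities.

Variables n d S : nat.
Hypothesis n8 : 8 <= n.
Hypothesis dn : 0 < d <= n - 2.

(* Convexity in d: d ^ 2 = (n + 2) * d - 4 * (n - 2) - (d - 4) * (n - 2 - d). *)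
Lemma unique_universal_row :
  S <= 3 * n.-1 -> 2 * S <= 4 * n.-1 + d * d.-1 -> S <= n.-1 + d.-1 * (n - 2) ->
  (n + 4) * ((3 * n + 8) * (d ^ 2 + S) + 4 * n.-1)
    <= (n ^ 2 + 6 * n + 4) * (3 * n + 8) * d.
Proof.
have mono T Y : S <= T -> (n + 4) * ((3 * n + 8) * (d ^ 2 + T) + 4 * n.-1) <= Y ->
    (n + 4) * ((3 * n + 8) * (d ^ 2 + S) + 4 * n.-1) <= Y.
  by move=> ST; apply: leq_trans; rewrite leq_mul2l leq_add2r leq_mul2l leq_add2l ST !orbT.
move=> S1 S2 S3.
have [e E] : exists e, n = e + 8 by exists (n - 8); lia.
case: d dn S2 S3 mono => [//|[|[|[|k]]]] /= kn S2 S3 mono.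
(* Degrees 1 and 2 use [S3], degree 3 uses the edge count [S2], and larger degrees use [S1]. *)
- apply: (mono (e + 7)); first lia.
  by rewrite E; clear; nia.
- apply: (mono (2 * e + 13)); first lia.
  by rewrite E; clear; nia.
- apply: (mono (2 * e + 17)); first lia.
  by rewrite E; clear; nia.
apply: mono S1 _.
have [f F] : exists f, n = k + f + 6 by exists (n - k - 6); lia.
(* This is the case [d = n - 2], where [k * f] vanishes; it is the tightest, since the term
   [4 * (3 * n + 8) * d] grows with [d]. *)
have Q : 4 * (n + 4) * n.-1 + 4 * (3 * n + 8) * (n - 2) <= (n + 4) * (3 * n + 8) * (n - 5).
  by rewrite E; clear; nia.
have R1 : (n ^ 2 + 6 * n + 4) * (3 * n + 8) * k.+4 + 4 * (3 * n + 8) * k.+4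
    = (n + 4) * (3 * n + 8) * (k.+4 ^ 2 + 4 * (n - 2) + k * f).
  have -> : n - 2 = k + f + 4 by lia.
  by rewrite F; clear; lia.
rewrite -(leq_add2r (4 * (3 * n + 8) * k.+4)) R1.
have : 4 * (3 * n + 8) * k.+4 <= 4 * (3 * n + 8) * (n - 2) by rewrite leq_mul2l; lia.
have -> : 4 * (n - 2) = 3 * n.-1 + (n - 5) by lia.
move: Q; move: (3 * n + 8) (n + 4) (n - 5) (n - 2) n.-1 k.+4 => K M x y z D Q H.
have := leq0n (M * K * (k * f)); move: Q H; clear; lia.
Qed.

(* Convexity in d: d ^ 2 = (n + 3) * d - 5 * (n - 2) - (d - 5) * (n - 2 - d). *)
Lemma no_universal_row :
  S + d <= 4 * n.-1 -> 2 * S <= 4 * n.-1 + d * d.-1 -> S <= d * (n - 2) ->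
  (n + 4) * (d ^ 2 + S) <= (n ^ 2 + 6 * n + 4) * d.
Proof.
have mono T Y : S <= T -> (n + 4) * (d ^ 2 + T) <= Y -> (n + 4) * (d ^ 2 + S) <= Y.
  by move=> ST; apply: leq_trans; rewrite leq_mul2l leq_add2l ST !orbT.
move=> S1 S2 S3.
have [e E] : exists e, n = e + 8 by exists (n - 8); lia.
case: d dn S1 S2 S3 mono => [//|[|[|[|[|k]]]]] /= kn S1 S2 S3 mono.
(* Degrees 1 and 2 use [S3], degrees 3 and 4 use [S2], and larger degrees use [S1]. *)
- apply: (mono (e + 6)); first lia.
  by rewrite E; clear; nia.
- apply: (mono (2 * e + 12)); first lia.
  by rewrite E; clear; nia.
- apply: (mono (2 * e + 17)); first lia.
  by rewrite E; clear; nia.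
- apply: (mono (2 * e + 20)); first lia.
  by rewrite E; clear; nia.
have [f F] : exists f, n = k + f + 7 by exists (n - k - 7); lia.
apply: (mono (4 * n.-1 - k.+1.+4)); first lia.
have Q : 4 * (n - 2) <= (n + 4) * (n - 6) by rewrite E; clear; nia.
have -> : 4 * n.-1 - k.+1.+4 = 3 * k + 4 * f + 19 by lia.
have R1 : (n ^ 2 + 6 * n + 4) * k.+1.+4 + 4 * k.+1.+4
    = (n + 4) * (k.+1.+4 ^ 2 + (3 * k + 4 * f + 19) + (n - 6) + k * f).
  have -> : n - 6 = k + f + 1 by lia.
  by rewrite F; clear; lia.
rewrite -(leq_add2r (4 * k.+1.+4)) R1.
have : 4 * k.+1.+4 <= 4 * (n - 2) by rewrite leq_mul2l; lia.
move: Q; move: (n + 4) (n - 6) (n - 2) k.+1.+4 (3 * k + 4 * f + 19) => M x y D z Q H.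
have := leq0n (M * (k * f)); move: Q H; clear; lia.
Qed.

End RowInequalities.

(** * Upper bounds by order *)

Section Cases.

Variables (R : realType) (G : sgraph).
Let n := #|G|.
Hypothesis total : \sum_(x : G) degree x = 4 * n.-1.

Lemma degree_le_pred (v : G) : degree v <= n.-1.
Proof. by have := degree_lt v; rewrite /n; lia. Qed.

Lemma degree_not_full (v : G) : degree v != n.-1 -> degree v <= n - 2.
Proof. by have := degree_le_pred v; lia. Qed.

Section UniversalAtMostOne.
Hypothesis at_most_one :
  forall u v : G, degree u = n.-1 -> degree v = n.-1 -> u = v.

Lemma others_le (u : G) : degree u = n.-1 -> forall v, v != u -> degree v <= n - 2.
Proof.
by move=> du v vu; apply: degree_not_full; apply: contra vu => /eqP dv; apply/eqP/at_most_one.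
Qed.

Lemma rho_le_large : 8 <= n ->
  (rho_alpha (2^-1 : R) G <= (n ^ 2 + 6 * n + 4)%N%:R / (n + 4)%N%:R / 2)%R.
Proof.
move=> n8; case: (pickP [pred u : G | degree u == n.-1]) => [u /eqP du|no].
  (* The factor [1 + 4 / (3 * n + 8)] makes the universal row an equality. *)
  apply: (@rho_le_unique_universal R G total u _ _ (3 * n + 8) 4) => //; try lia.
  - exact: others_le.
  - by move=> d S; exact: unique_universal_row.
apply: (@rho_le_no_universal R G total) => //; first lia.
- by move=> v; apply: degree_not_full; apply/negbT/no.
- by move=> d S; exact: no_universal_row.
Qed.

(* The largest eigenvalue of the quasi-star is about 6.83 for n = 5. *)
Lemma rho_le_5 : n = 5 -> (rho_alpha (2^-1 : R) G <= 661%:R / 100%:R / 2)%R.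
Proof.
move=> n5; case: (pickP [pred u : G | degree u == n.-1]) => [u /eqP du|no].
  (* With factor 23 / 20 the universal row gives 152 / 23, just below 6.61. *)
  apply: (@rho_le_unique_universal R G total u _ _ 20 3) => //; rewrite -/n ?n5 //.
  - by move=> v; rewrite -[3]/(5 - 2) -n5; exact: others_le.
  - by move=> [|[|[|[|d]]]] S //=; lia.
apply: (@rho_le_no_universal R G total) => //.
- by move=> v; apply: degree_not_full; apply/negbT/no.
- by rewrite -/n n5 => -[|[|[|[|d]]]] S //=; lia.
Qed.

End UniversalAtMostOne.

Lemma card_nbr_sub (P : pred G) (v : G) :
  #|[pred u | edge v u & P u]| + P v <= #|P|.
Proof.
rewrite [#|P|](cardD1 v) addnC unfold_in leq_add2l; apply: subset_leq_card.
apply/fintype.subsetP => u; rewrite !inE => /andP[evu Pu]; rewrite unfold_in Pu andbT.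
by apply: contraTneq evu => ->; rewrite edge_irr.
Qed.

(* 8 is the largest eigenvalue of K_5 u K_1, so the bound only has to be below 8. *)
Lemma rho_le_6 : n = 6 ->
  (exists2 w : G, degree w = 0 & forall x, x != w -> degree x = 4) \/
  (rho_alpha (2^-1 : R) G <= 796%:R / 100%:R / 2)%R.
Proof.
move=> n6; case: (pickP [pred u : G | degree u == n.-1]) => [u /eqP du|no].
  right; have pos : forall y : G, 0 < degree y.
    by apply: universal_no_isolated du; rewrite -/n n6.
  pose P := [pred v : G | degree v == 5].
  (* Six degrees, each at least 1 and exceeding 1 by 4 on [P], sum to 20. *)
  have P3 : #|P| <= 3.
    have : \sum_(v : G) (1 + 4 * P v) <= \sum_(v : G) degree v.
      apply: leq_sum => v _ /=; case: eqP => [->|] //=; have := pos v; lia.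
    rewrite total big_split /= sum1_card -/n n6 -big_distrr /=.
    have -> : \sum_(v : G) (degree v == 5) = #|P|.
      by rewrite -sum1_card [RHS]big_mkcond; apply: eq_bigr => v _; rewrite inE /=; case: (degree v == 5).
    by lia.
  have bound (v : G) : 0 < degree v <= 5 /\ [/\ nbr_sum v <= 15,
      2 * nbr_sum v <= 20 + degree v * (degree v).-1 & nbr_sum v <= degree v * 5].
    rewrite pos; split; first by have := degree_le_pred v; rewrite n6.
    have := nbr_sum_le_no_isolated v pos; have := nbr_sum_le_half v.
    rewrite total -/n n6 => ? ?; split=> //; first by lia.
    by apply: nbr_sum_le_max => y _; have := degree_le_pred y; rewrite n6.
  (* With factor 21 / 20 a universal row has at most two neighbours in [P] and gives at most 167 /
     21 < 7.96, while the other rows stay below 7.96. *)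
  apply: (@rho_le_weighted_nat R G P 5 _ _ 20 1) => //.
  - by move=> v /eqP.
  - move=> v Pv _; have [d5 [S15 Sh S5]] := bound v.
    have : #|[pred u | edge v u & P u]| <= 3.
      by apply: leq_trans P3; apply: leq_trans (card_nbr_sub P v); rewrite leq_addr.
    move: Pv d5 S15 Sh S5; rewrite /=; move: #|_| (nbr_sum v) (degree v) => k S.
    by move=> [|[|[|[|[|[|d]]]]]] //=; lia.
  - move=> v Pv; have [_ [S15 _ _]] := bound v.
    have : #|[pred u | edge v u & P u]| <= 2.
      by rewrite -ltnS; apply: leq_trans P3; have := card_nbr_sub P v; rewrite Pv addn1.
    by move: #|_| => k; lia.
have d4 (v : G) : degree v <= 4.
  by rewrite -[4]/(6 - 2) -n6; apply: degree_not_full; apply/negbT/no.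
case: (pickP [pred v : G | (degree v == 4) && (15 < nbr_sum v)]) => [v /andP[/eqP dv Sv]|no'].
  left; have := nonnbr_card v; rewrite dv -/n n6 => /eqP.
  rewrite -[5]/(1 + 4) eqn_add2r => /eqP/mem_card1[w Ew].
  (* The degree total is 20, and [v] with its neighbours already accounts for at least 4 + 16. *)
  have dw : degree w = 0.
    have := nbr_sumE v; rewrite total dv n6 (bigD1 w) /=; first by lia.
    by have := Ew w; rewrite !inE eqxx.
  exists w => // x xw; apply/eqP; rewrite eqn_leq d4 -subn_eq0 /=.
  (* Five degrees of at most 4 sum to 20, so all of them equal 4. *)
  have : \sum_(y | y != w) (4 - degree y) = 0.
    apply/eqP; rewrite -(eqn_add2r (\sum_(y | y != w) degree y)) -big_split /=.
    have := total; rewrite (bigD1 w) //= dw !add0n n6 => ->.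
    rewrite (eq_bigr (fun=> 4)) => [|y _]; last by rewrite subnK.
    by rewrite sum_nat_const cardC1 -/n n6.
  by move/eqP; rewrite sum_nat_eq0 => /forallP/(_ x); rewrite xw.
right; apply: rho_le_degree_nat => // v dv.
have := d4 v; have := no' v; have := nbr_sum_le_half v; rewrite total n6 /=.
have : nbr_sum v <= degree v * 4 by apply: nbr_sum_le_max => y _.
by move: (nbr_sum v) (degree v) dv => S [|[|[|[|[|d]]]]] //=; lia.
Qed.

(* The largest eigenvalue of the quasi-star is about 8.735 for n = 7. Plain
   degree weights give 8.8 when a vertex of degree 5 misses an isolated vertex;
   then the (at most three) vertices of degree 5 are weighted by 21 / 20. *)
Lemma rho_le_7 : n = 7 ->
  (forall u v : G, degree u = n.-1 -> degree v = n.-1 -> u = v) ->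
  (rho_alpha (2^-1 : R) G <= 873%:R / 100%:R / 2)%R.
Proof.
move=> n7 one; case: (pickP [pred u : G | degree u == n.-1]) => [u /eqP du|no].
  (* With factor 11 / 10 the universal row gives 96 / 11, just below 8.73. *)
  apply: (@rho_le_unique_universal R G total u _ _ 10 1) => //; rewrite -/n ?n7 //.
  - by move=> v; rewrite -[5]/(7 - 2) -n7; exact: others_le.
  - by move=> [|[|[|[|[|[|d]]]]]] S //=; lia.
have d5 (v : G) : degree v <= 5.
  by rewrite -[5]/(7 - 2) -n7; apply: degree_not_full; apply/negbT/no.
have bound (v : G) : [/\ nbr_sum v + degree v <= 24,
    2 * nbr_sum v <= 24 + degree v * (degree v).-1 & nbr_sum v <= degree v * 5].
  have := nbr_sum_le_total v; have := nbr_sum_le_half v.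
  by rewrite total n7; split=> //; apply: nbr_sum_le_max.
case: (pickP [pred v : G | (degree v == 5) && (18 < nbr_sum v)]) => [v /andP[/eqP dv Sv]|no'].
  have := nonnbr_card v; rewrite dv -/n n7 => /eqP.
  rewrite -[6]/(1 + 5) eqn_add2r => /eqP/mem_card1[w Ew].
  have dw : degree w = 0.
    have := nbr_sumE v; rewrite total dv n7 (bigD1 w) /=; first by lia.
    by have := Ew w; rewrite !inE eqxx.
  have ew y : edge w y = false by exact: isolated_edge.
  pose P := [pred v : G | degree v == 5].
  have P3 : #|P| <= 3.
    rewrite leqNgt; apply/negP => P4.
    (* A vertex of degree 5 is adjacent to all but [w], so four of them would give every vertex
       other than [w] degree at least 4, and a total of at least 6 * 4 + 4 > 24. *)
    have : \sum_(x | x != w) (4 + P x) <= \sum_(x | x != w) degree x.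
      apply: leq_sum => x xw; rewrite inE; case: eqP => [->//|/eqP dx].
      rewrite addn0; apply: leq_trans P4 _; rewrite /degree cardsE.
      apply: subset_leq_card; apply/fintype.subsetP => y; rewrite !inE => /eqP dy.
      rewrite -[_ \in _]/(edge x y) edge_sym.
      have yw : y != w by apply: contra_eqN dy => /eqP->; rewrite dw.
      rewrite (edge_of_codegree1 (w := w)) -/n ?n7 //; last by rewrite edge_sym ew.
      by rewrite xw andbT; apply: contraNneq dx => <-; rewrite dy.
    have := total; rewrite (bigD1 w) //= dw add0n n7 => ->.
    rewrite big_split /= sum_nat_const.
    have -> : #|[pred x | x != w]| = 6.
      by rewrite cardC1 -/n n7.
    have -> : \sum_(x : G | x != w) (degree x == 5) = #|P|.
      rewrite -sum1_card [LHS]big_mkcond [RHS]big_mkcond; apply: eq_bigr => x _.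
      by rewrite inE /=; case: (eqVneq x w) => [->|_] /=; [rewrite dw | case: (degree x == 5)].
    by lia.
  apply: (@rho_le_weighted_nat R G P 5 _ _ 20 1) => //.
  - by move=> x /eqP.
  - move=> x Px dx; have [S24 Sh S5] := bound x.
    have : #|[pred u | edge x u & P u]| <= 3.
      by apply: leq_trans P3; apply: leq_trans (card_nbr_sub P x); rewrite leq_addr.
    move: Px dx (d5 x) S24 Sh S5; rewrite /=; move: #|_| (nbr_sum x) (degree x) => k S.
    by move=> [|[|[|[|[|[|d]]]]]] //=; lia.
  - move=> x Px; have [S19 _ _] := bound x.
    have : #|[pred u | edge x u & P u]| <= 2.
      by rewrite -ltnS; apply: leq_trans P3; have := card_nbr_sub P x; rewrite Px addn1.
    by move: S19; rewrite (eqP Px); move: #|_| => k; lia.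
apply: rho_le_degree_nat => // v dv.
have [S24 Sh S5] := bound v; have := no' v; rewrite /=.
by move: (nbr_sum v) (degree v) dv (d5 v) S24 Sh S5 => S [|[|[|[|[|[|d]]]]]] //=; lia.
Qed.

End Cases.

(** * Comparison with the quasi-star and conclusion *)

Lemma rho_lt_quasi_star (R : realType) (G : sgraph) :
  4 < #|G| -> #|G| <> 6 -> \sum_(x : G) degree x = 4 * #|G|.-1 ->
  (forall u v : G, degree u = #|G|.-1 -> degree v = #|G|.-1 -> u = v) ->
  (rho_alpha (2^-1 : R) G
    < rho_alpha (2^-1 : R) (gjoin (complete 2) (gunion (star 1) (edgeless (#|G| - 4)))))%R.
Proof.
move=> n4 n6 total one.
have [n8|n8] := leqP 8 #|G|.
  apply: le_lt_trans (rho_le_large R total one n8) _.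
  have [p pE] : exists p, #|G| = p + 4 by exists (#|G| - 4); lia.
  have p4 : 4 <= p by lia.
  rewrite pE addnK; set x : R := p%:R%R.
  have x4 : (4 <= x)%R by rewrite (ler_nat R 4).
  have -> : (((p + 4) ^ 2 + 6 * (p + 4) + 4)%N%:R / (p + 4 + 4)%N%:R
            = x + 6 - 4 / (x + 8) :> R)%R.
    rewrite !natrD !natrM !natrD -/x.
    by field; rewrite gt_eqF //; lra.
  have y0 : (0 < (x + 8)^-1 :> R)%R by rewrite invr_gt0; lra.
  have y1 : ((x + 8)^-1 * (x + 8) = 1 :> R)%R by rewrite mulVf // gt_eqF //; lra.
  have y2 : ((x + 8)^-1 <= 12^-1 :> R)%R by rewrite lef_pV2 ?posrE; lra.
  apply: qs_rho_gt; rewrite ?natrD -/x; try lra.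
  rewrite -subr_gt0.
  (* Here [x + 4] is the order [n]: minus the cubic at [n + 2 - 4 / (n + 4)] is a positive
     polynomial in [n] over the cube of [n + 4]. *)
  have -> : (4 * (x + 6 - 4 / (x + 8) - 2) + 2 * x * (x + 6 - 4 / (x + 8) - 4) -
     (x + 6 - 4 / (x + 8) - (x + 4)) * (x + 6 - 4 / (x + 8) - 4) * (x + 6 - 4 / (x + 8) - 2)
     = (32 * (x + 4) ^+ 2 + 384 * (x + 4) + 1088) * (x + 8)^-1 ^+ 3)%R.
    by field; rewrite gt_eqF //; lra.
  by rewrite mulr_gt0 ?exprn_gt0 // ; have := sqr_ge0 (x + 4)%R; lra.
have [n5|n7] : #|G| = 5 \/ #|G| = 7 by lia.
  apply: le_lt_trans (rho_le_5 R total one n5) _.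
  by rewrite n5 -[5 - 4]/1; apply: qs_rho_gt; rewrite -?[(1 + 4)%N]/5 -?[(1 + 6)%N]/7; lra.
apply: le_lt_trans (rho_le_7 R total n7 one) _.
by rewrite n7 -[7 - 4]/3; apply: qs_rho_gt; rewrite -?[(3 + 4)%N]/7 -?[(3 + 6)%N]/9; lra.
Qed.

Lemma graph_class_degree_sum (G : sgraph) n : 0 < n -> graph_class n (2 * n - 2) G ->
  \sum_(x : G) degree x = 4 * #|G|.-1.
Proof. by move=> n0 [<- E]; rewrite handshake E; lia. Qed.

Theorem theorem1p2 (R : realType) (n : nat) (G' : sgraph) :
  (4 <= n)%N ->
  attains_max_rho (2%:R^-1 : R)%R n (2 * n - 2)%N G' ->
  (n = 6 -> isomorphic G' (gunion (complete 5) (complete 1))) /\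
  (n <> 6 -> isomorphic G' (quasi_star n (2 * n - 2)%N)).
Proof.
move=> n4 [cG maxG]; have total := graph_class_degree_sum (ltnW (ltnW (ltnW n4))) cG.
have Gn : #|G'| = n by case: cG.
have G0 : 0 < #|G'| by lia.
split=> [n6|n6].
  have [[w dw d4]|rho_le] := rho_le_6 R total (etrans Gn n6).
    (* The isolated vertex has position 0 and every other vertex position 1. *)
    pose s' : seq (gunion (complete 5) (complete 1)) := [:: inr ord0].
    apply: (@isomorphic_of_prefix _ _ [:: w] s' (fun i j => (0 < i) && (0 < j))) => //.
    - by rewrite Gn n6 card_sum !card_ord.
    - move=> x y; rewrite (K5_K1_shape (etrans Gn n6) dw d4) /= ![w == _]eq_sym.
      by do 2!case: (_ == w).
    - by move=> [i|i] [j|j] /=; rewrite ?(ord1 i) ?(ord1 j) ?eqxx ?andbT.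
  have K5 := K5_K1_class; rewrite -[10]/(2 * 6 - 2) -n6 in K5.
  have := le_trans (le_trans (K5_K1_rho R) (maxG _ K5)) rho_le.
  by lra.
have [n5|] := ltnP 4 n; last first.
  move=> n4'; have {n4 n4'} n4 : n = 4 by lia.
  (* Four degrees of at most 3 sum to 12, so the graph is complete. *)
  have degree3 (x : G') : degree x = 3.
    have le3 (y : G') : degree y <= 3 by have := degree_lt y; rewrite Gn n4.
    apply/eqP; rewrite eqn_leq le3 leqNgt /=; apply/negP => dx.
    have := total; rewrite (bigD1 x) //= Gn n4.
    have : \sum_(y : G' | y != x) degree y <= \sum_(y : G' | y != x) 3 by apply: leq_sum.
    by rewrite sum_nat_const cardC1 Gn n4; lia.
  rewrite n4 quasi_star_4.
  apply: (@isomorphic_of_prefix _ _ [::] [::] (fun _ _ => true)) => //.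
  - by rewrite Gn n4 !card_sum !card_ord.
  - by move=> x y; rewrite andbT (degree_full (x := x)) // (degree3 x) Gn n4.
  - by case=> [i|[[i|i]|i]] [j|[[j|j]|j]] /=; rewrite ?(ord1 i) ?(ord1 j) ?andbT ?eqxx //;
      case: i j => // ? ? [].
rewrite quasi_star_2n2 //.
have card_eq : #|G'| = #|gjoin (complete 2) (gunion (star 1) (edgeless (n - 4)))|.
  by rewrite card_qs Gn; lia.
have [/existsP[u1 /existsP[u2 /and3P[u12 /eqP d1 /eqP d2]]]|no] :=
  boolP [exists u : G', exists v : G', [&& u != v, degree u == #|G'|.-1 & degree v == #|G'|.-1]].
  have [s [us ss Es]] := two_universal_shape u12 d1 d2 total.
  have [s' [us' ss' Es']] := qs_shape (n - 4).
  by apply: (isomorphic_of_prefix G0 card_eq us us' _ Es Es'); rewrite ss ss'.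
have one (u v : G') : degree u = #|G'|.-1 -> degree v = #|G'|.-1 -> u = v.
  move=> du dv; apply: contraNeq no => uv; apply/existsP; exists u.
  by apply/existsP; exists v; rewrite uv du dv !eqxx.
(* Without two universal vertices the quasi-star has strictly larger radius, against maximality. *)
have := rho_lt_quasi_star R _ _ total one; rewrite Gn => /(_ n5 n6).
rewrite ltNge maxG //; split; first by rewrite -card_eq.
by rewrite qs_edges; lia.
Qed.
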